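(* Let $n\ge1$, $k\ge2$, $\epsilon_1\in\{1,-1\}$, and let $P(\lambda)=\sum_{j=0}^k\lambda^jA_j$, $A_j\in\mathbb{C}^{n\times n}$, be an $(H,\epsilon_1,-1)$-structured matrix polynomial (i.e. $A_j^H=\epsilon_1A_j$ for even $j$ and $A_j^H=-A_j$ for odd $j$) with $A_k$ nonsingular, all of whose eigenvalues are semi-simple. Let $(X,J)\in\mathbb{C}^{n\times kn}\times\mathbb{C}^{kn\times kn}$ be a standard pair of $P(\lambda)$ with $X=[X_1,\ldots,X_s]$, $J=\mathrm{diag}(J_1,\ldots,J_s)$, where the spectra of the $J_j$ are pairwise disjoint and: if $\epsilon_1=-1$, $J_j=\mathrm{diag}(\lambda_jI_{n_j},\bar\lambda_jI_{n_j})$ with $\lambda_j\in\mathbb{C}\setminus\mathbb{R}$ for $j=1,\ldots,r$, and $J_j=\lambda_jI_{n_j}$ with $\lambda_j\in\mathbb{R}$ for $j=r+1,\ldots,s$; if $\epsilon_1=1$, $J_j=\mathrm{diag}(\lambda_jI_{n_j},-\bar\lambda_jI_{n_j})$ with $\lambda_j\in\mathbb{C}\setminus\mathrm{i}\mathbb{R}$ for $j=1,\ldots,r$, and $J_j=\lambda_jI_{n_j}$ with $\lambda_j\in\mathrm{i}\mathbb{R}$ for $j=r+1,\ldots,s$. Then there exists a standard pair $(\tilde X,J)$ of $P(\lambda)$ such that the corresponding matrix $\tilde\Gamma\in\mathcal{S}_{(J,H,\epsilon_1,-1)}$ has the structure $$\tilde\Gamma=\mathrm{diag}\left(\begin{bmatrix}0&I_{n_1}\\-I_{n_1}&0\end{bmatrix},\cdots,\begin{bmatrix}0&I_{n_r}\\-I_{n_r}&0\end{bmatrix},E_{n_{r+1}},\cdots,E_{n_s}\right),$$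 where $E_{n_j}=\mathrm{diag}(\pm\mathrm{i},\ldots,\pm\mathrm{i})$ is $n_j\times n_j$, $j=r+1,\ldots,s$.
   Context: $(X,J)$ is a standard pair of $P$ if the matrix $X_L$ obtained by stacking $X,XJ,\ldots,XJ^{k-1}$ (top to bottom) is nonsingular and $\sum_{i=0}^kA_iXJ^i=0$. An eigenvalue is semi-simple if its algebraic and geometric multiplicities coincide. $\mathrm{i}=\sqrt{-1}$ and $\mathrm{i}\mathbb{R}$ is the set of purely imaginary numbers (including $0$). $\mathcal{S}_{(J,H,\epsilon_1,-1)}=\{S\in\mathbb{C}^{kn\times kn}:S^H=-S,\ SJ^H=-\epsilon_1JS\}$. The matrix corresponding to a standard pair $(X,J)$ of $P$ is $\Gamma=(X_L^H\mathcal{A}X_L)^{-1}$, where $\mathcal{A}\in\mathbb{C}^{kn\times kn}$ is the $k\times k$ block matrix whose $(p,q)$ block is $(-\epsilon_1)^{p-1}A_{p+q-1}$ if $p+q\le k+1$ and $0$ otherwise. *)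

(* Defs.v *)
From mathcomp Require Import all_boot all_order all_algebra.

Set Implicit Arguments.
Unset Strict Implicit.
Unset Printing Implicit Defensive.

Import Order.TTheory GRing.Theory Num.Theory.
Local Open Scope ring_scope.
Local Open Scope sesquilinear_scope.

(* The dimension kn is kept in the form \sum_(i < k) n, which is the dimension
   MathComp gives to a column of k blocks of height n (\mxcol, \mxblock). *)
Notation blockdim k n := (\sum_(i < k) n)%N.

Section MatrixPolynomial.
Variables (C : numClosedFieldType) (n k : nat).
(* The polynomial P(z) = \sum_(j < k.+1) z ^+ j *: A j. *)
Variable A : 'I_k.+1 -> 'M[C]_n.

Definition matpoly : 'M[{poly C}]_n :=
  \sum_(j < k.+1) 'X^j *: map_mx polyC (A j).

Definition matpoly_eval (z : C) : 'M[C]_n := \sum_(j < k.+1) z ^+ j *: A j.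

Definition matpoly_eigenvalue (z : C) : bool := \det (matpoly_eval z) == 0.

Definition alg_mult (z : C) : nat := mup z (\det matpoly).

(* cokermx M spans {v | M *m v = 0}, so this is dim ker P(z). *)
Definition geom_mult (z : C) : nat := \rank (cokermx (matpoly_eval z)).

Definition all_semisimple : Prop :=
  forall z, matpoly_eigenvalue z -> alg_mult z = geom_mult z.

Definition structured (eps1 : C) : Prop :=
  forall j : 'I_k.+1, (A j)^t* = if odd j then - A j else eps1 *: A j.

Definition stackX (X : 'M[C]_(n, blockdim k n)) (J : 'M[C]_(blockdim k n)) :
    'M[C]_(blockdim k n) :=
  \mxcol_(i < k) (X *m J ^+ i).

Definition standard_pair (X : 'M[C]_(n, blockdim k n))
    (J : 'M[C]_(blockdim k n)) : Prop :=
  stackX X J \in unitmx /\ \sum_(i < k.+1) A i *m X *m J ^+ i = 0.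

(* p and q count from 0 here: the 1-based block (p + 1, q + 1) carries the
   coefficient of index p + q + 1, and the sign exponent is p. *)
Definition coefmx (eps1 : C) : 'M[C]_(blockdim k n) :=
  \mxblock_(p < k, q < k)
    (if (p + q + 1 <= k)%N then (- eps1) ^+ p *: A (inord (p + q + 1)) else 0).

Definition Gamma (eps1 : C) (X : 'M[C]_(n, blockdim k n))
    (J : 'M[C]_(blockdim k n)) : 'M[C]_(blockdim k n) :=
  invmx ((stackX X J)^t* *m coefmx eps1 *m stackX X J).

End MatrixPolynomial.

(* The set S_(J,H,eps1,-1). *)
Definition Sset (C : numClosedFieldType) (N : nat) (J : 'M[C]_N) (eps1 : C)
    (S : 'M[C]_N) : Prop :=
  S^t* = - S /\ S *m J^t* = - eps1 *: (J *m S).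

(* The axis of symmetry of the spectrum: R if eps1 = -1, iR if eps1 = 1;
   mirror is the reflection in that axis. *)
Definition on_axis (C : numClosedFieldType) (eps1 z : C) : bool :=
  if eps1 == -1 then z \is Num.real else 'Re z == 0.

Definition mirror (C : numClosedFieldType) (eps1 z : C) : C :=
  if eps1 == -1 then z^* else - z^*.

Section Blocks.
Variables (C : numClosedFieldType) (r s : nat) (nn : 'I_s -> nat).

(* Blocks are numbered from 0, so that j < r singles out the first r of them. *)
Definition bsize (j : 'I_s) : nat := if (j < r)%N then (nn j + nn j)%N else nn j.

Definition Jblock (eps1 : C) (lam : 'I_s -> C) (j : 'I_s) : 'M[C]_(bsize j) :=
  if (j < r)%N as b return 'M[C]_(if b then (nn j + nn j)%N else nn j)
  then block_mx (lam j)%:M 0 0 (mirror eps1 (lam j))%:M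
  else (lam j)%:M.

(* The block diag(+-i, ..., +-i), with sign -1 where sg holds. *)
Definition Eblock (m : nat) (sg : 'I_m -> bool) : 'M[C]_m :=
  diag_mx (\row_(l < m) ((-1) ^+ sg l * 'i)).

Definition Gblock (sg : forall j : 'I_s, 'I_(nn j) -> bool) (j : 'I_s) :
    'M[C]_(bsize j) :=
  if (j < r)%N as b return 'M[C]_(if b then (nn j + nn j)%N else nn j)
  then block_mx 0 1%:M (- 1%:M) 0
  else Eblock (sg j).

End Blocks.

(* Main.v *)
(* The matrix M = X_L^H A X_L is skew-Hermitian and invertible, and the relation
   sum_i A_i X J^i = 0 makes the double sum for M J - (- eps1) J^H M telescope to
   0. As J is diagonal, an entry M_ab can be nonzero only if J_bb is the mirror
   image of J_aa; the spectra of the J_j being disjoint and mirror-symmetric, M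
   is block diagonal. Replacing X by X T, with T invertible and commuting with
   J, replaces M by T^H M T, so each block of M can be normalised separately:
   an off-axis block is [0, B; -B^H, 0] with B invertible, and an on-axis block
   is unitarily diagonalisable with nonzero imaginary entries, which a positive
   rescaling turns into +-i. *)
Require Import Defs.
From mathcomp Require Import all_boot all_order all_algebra complex reals zify ring.

Set Implicit Arguments.
Unset Strict Implicit.
Unset Printing Implicit Defensive.

Import Order.TTheory GRing.Theory Num.Theory.
Local Open Scope ring_scope.

(** * Reflection in the axis, and normal forms of a single block under congruence *)

Section Blocks.
Local Open Scope sesquilinear_scope.
Variable C : numClosedFieldType.

Lemma adjmxM m n p (A : 'M[C]_(m, n)) (B : 'M[C]_(n, p)) :
  (A *m B)^t* = B^t* *m A^t*.
Proof. by rewrite trmx_mul map_mxM. Qed.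

Lemma mirrorE (eps z : C) :
  eps = 1 \/ eps = -1 -> mirror eps z = - eps * z^*.
Proof.
rewrite /mirror; case=> ->; last by rewrite eqxx opprK mul1r.
by rewrite -addr_eq0 -mulr2n pnatr_eq0 mulN1r.
Qed.

Lemma mirrorK (eps : C) : eps = 1 \/ eps = -1 -> involutive (mirror eps).
Proof.
move=> heps z; rewrite !mirrorE //.
by case: heps => ->; rewrite ?opprK ?mulN1r ?mul1r ?rmorphN /= conjCK ?opprK.
Qed.

Lemma on_axisE (eps z : C) :
  eps = 1 \/ eps = -1 -> on_axis eps z = (mirror eps z == z).
Proof.
move=> heps; rewrite /on_axis /mirror; case: ifP => _; first by rewrite CrealE.
rewrite ReE mulf_eq0 invr_eq0 pnatr_eq0 orbF.
by rewrite addrC addr_eq0 eqr_oppLR.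
Qed.

(** The product [|d|^-1 * d * 'i] is real of modulus 1, so it is 1 or -1, and [b] records which. *)
Lemma skew_diag_entry (d : C) : d != 0 -> d^* = - d ->
  exists b : bool, `|d|^-1 * d * ((-1) ^+ b * 'i) = 1.
Proof.
move=> d0 hd; have n0: `|d| != 0 by rewrite normr_eq0.
pose e := `|d|^-1 * d * 'i.
have ereal : e^* = e.
  rewrite /e !rmorphM fmorphV /= hd conjCi.
  by rewrite (CrealP (normr_real d)) mulrN mulrN mulNr opprK.
have /eqP : e ^+ 2 = 1.
  rewrite expr2 -{1}ereal mulrC -normCK /e !normrM normrV ?unitfE //.
  by rewrite normr_id normCi mulVf // mulr1 expr1n.
rewrite -subr_eq0 subr_sqr_1 mulf_eq0 subr_eq0 addr_eq0.
case/orP=> /eqP he; [exists false|exists true].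
  by rewrite expr0 mul1r.
by rewrite expr1 mulN1r mulrN -/e he opprK.
Qed.

(** A skew-Hermitian matrix is normal, hence unitarily diagonalisable; scaling each eigenvector by
    [|d|^(-1/2)] brings the imaginary eigenvalues to modulus 1. The conclusion is a product equal to
    1 because the target is the inverse of the congruent matrix, as in [Gamma]. *)
Lemma skew_unit_congr_Eblock m (W : 'M[C]_m) :
  W^t* = - W -> W \in unitmx ->
  exists (T : 'M[C]_m) (sg : 'I_m -> bool), T^t* *m W *m T *m Eblock C sg = 1%:M.
Proof.
move=> hW uW.
have nW : W \is normalmx by apply/normalmxP; rewrite hW mulmxN mulNmx.
set P := spectralmx W; set d := spectral_diag W.
have Pu : P \is unitarymx := spectral_unitarymx W.
have defW : P *m W *m P^t* = diag_mx d.
  rewrite (orthomx_spectralP nW) -/P -/d invmx_unitary //.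
  rewrite !mulmxA (unitarymxP Pu) mul1mx -mulmxA (unitarymxP Pu) mulmx1 //.
have du a : d 0 a != 0.
  have : diag_mx d \in unitmx.
    by rewrite -defW !unitmx_mul uW unitarymx_unit // unitarymx_unit ?trmxC_unitary.
  by rewrite unitmxE det_diag unitfE => /prodf_neq0 /(_ a isT).
have dskew a : (d 0 a)^* = - d 0 a.
  have: (diag_mx d)^t* = - diag_mx d.
    by rewrite -defW !adjmxM trmxCK hW mulNmx mulmxN mulmxA.
  by move/matrixP/(_ a a); rewrite !mxE eqxx !mulr1n.
have [sg hsg] : exists sg : 'I_m -> bool,
    forall a, `|d 0 a|^-1 * d 0 a * ((-1) ^+ sg a * 'i) = 1.
  exact: fin_all_exists (fun a => skew_diag_entry (du a) (dskew a)).
pose c : 'rV[C]_m := \row_a sqrtC (`|d 0 a|^-1).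
exists (P^t* *m diag_mx c), sg.
have cR : (diag_mx c)^t* = diag_mx c.
  apply/matrixP=> i j; rewrite !mxE rmorphMn /= eq_sym.
  case: eqP => [->|] //; rewrite ?mulr0n // !mulr1n.
  by apply/CrealP; rewrite ger0_real // sqrtC_ge0 invr_ge0.
rewrite adjmxM trmxCK cR.
have -> : diag_mx c *m P *m W *m (P^t* *m diag_mx c) =
    diag_mx c *m diag_mx d *m diag_mx c.
  by rewrite -defW !mulmxA.
apply/matrixP=> i j.
rewrite /Eblock -!mulmxA !mul_diag_mx !mxE.
case: (eqVneq i j) => [->|]; rewrite ?mulr0n ?mulr0 // !mulr1n.
by rewrite -[RHS](hsg j) -[in RHS](sqrtCK `|d 0 j|^-1) expr2 !mulrA [_ * d 0 j * _]mulrAC.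
Qed.
Lemma skew_unit_congr_symplectic m (W : 'M[C]_(m + m)) (l u : C) (eps : C) :
  eps = 1 \/ eps = -1 -> u = mirror eps l -> u != l ->
  W^t* = - W -> W \in unitmx ->
  W *m block_mx l%:M 0 0 u%:M = - eps *: ((block_mx l%:M 0 0 u%:M)^t* *m W) ->
  exists2 T : 'M[C]_(m + m),
    T *m block_mx l%:M 0 0 u%:M = block_mx l%:M 0 0 u%:M *m T
    & T^t* *m W *m T *m block_mx 0 1%:M (- 1%:M) 0 = 1%:M.
Proof.
move=> heps hu neq hW uW.
rewrite -[W]submxK in hW uW *.
move: (ulsubmx W) (ursubmx W) (dlsubmx W) (drsubmx W) hW uW => a b c d hW uW hcomm.
have el : - eps * u^* = l by rewrite -mirrorE // hu mirrorK.
have eu : - eps * l^* = u by rewrite -mirrorE.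
have scal0 (x y : C) (Z : 'M[C]_m) : x != y -> x *: Z = y *: Z -> Z = 0.
  move=> nxy /eqP; rewrite -subr_eq0 -scalerBl scaler_eq0 subr_eq0.
  by rewrite (negbTE nxy) => /eqP.
(* Blockwise, the commutation relation says [l a = u a] and [u d = l d], with [l] and [u]
   distinct. *)
have [a0 d0] : a = 0 /\ d = 0.
  move: hcomm; rewrite tr_block_mx map_block_mx !mulmx_block scale_block_mx.
  rewrite !trmx0 !map_mx0 !tr_scalar_mx !map_scalar_mx !mulmx0 !mul0mx !addr0 !add0r.
  rewrite !mul_mx_scalar !mul_scalar_mx !scalerA el eu.
  case/eq_block_mx=> h1 _ _ h4; split; last exact: scal0 h4.
  by apply: scal0 (esym h1).
rewrite {}a0 {}d0 in hW uW hcomm *.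
have hc : c = - b^t*.
  move: hW; rewrite tr_block_mx map_block_mx opp_block_mx.
  by case/eq_block_mx=> _ _ -> _; rewrite opprK.
have ub : b \in unitmx.
  move: (mulmxV uW); rewrite -[invmx _]submxK mulmx_block scalar_mx_block.
  by case/eq_block_mx; rewrite mul0mx add0r => /mulmx1_unit[].
(* The minus sign makes the congruent matrix [[0, -1; 1, 0]], the inverse of [[0, 1; -1, 0]]. *)
exists (block_mx 1%:M 0 0 (- invmx b)).
  rewrite !mulmx_block !mulmx0 !mul0mx !mulmx1 !mul1mx !addr0 !add0r.
  by rewrite scalar_mxC.
rewrite tr_block_mx map_block_mx !mulmx_block.
rewrite !(trmx0, trmx1, map_mx0, map_mx1).
rewrite !(mulmx0, mul0mx, mulmx1, mul1mx, addr0, add0r, mulmxN, opprK).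
rewrite mulmxV // hc mulmxN -adjmxM mulmxN mulmxV // linearN /= map_mxN opprK.
by rewrite trmx1 map_mx1 scalar_mx_block.
Qed.

(** Quantifying over every family [sg] that takes the value [sgj] at [j] lets the signs, chosen
    block by block, be assembled into one family afterwards. *)
Lemma Jblock_congr r s (nn : 'I_s -> nat) (eps : C) (lam : 'I_s -> C) j
    (W : 'M[C]_(bsize r nn j)) :
  eps = 1 \/ eps = -1 -> ((j < r)%N -> ~~ on_axis eps (lam j)) ->
  W^t* = - W -> W \in unitmx ->
  W *m Jblock r nn eps lam j = - eps *: ((Jblock r nn eps lam j)^t* *m W) ->
  exists (sgj : 'I_(nn j) -> bool) (T : 'M[C]_(bsize r nn j)),
    T *m Jblock r nn eps lam j = Jblock r nn eps lam j *m T /\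
    forall sg, sg j = sgj -> T^t* *m W *m T *m Gblock C r sg j = 1%:M.
Proof.
move=> heps hoff; move: W; rewrite /Jblock /Gblock /bsize.
case: (j < r)%N hoff => [/(_ isT) hoff | _] W hW uW.
  rewrite on_axisE // in hoff.
  case/(skew_unit_congr_symplectic heps erefl hoff hW uW) => T hT hG.
  by exists (fun=> false), T; split.
have [T [sgj hT]] := skew_unit_congr_Eblock hW uW => _.
by exists sgj, T; split=> [|sg ->]; rewrite ?scalar_mxC.
Qed.

(** * Block diagonality forced by disjoint, mirror-symmetric spectra *)

Lemma eigenvalue_diag_mx m (d : 'rV[C]_m) a : eigenvalue (diag_mx d) (d 0 a).
Proof.
apply/eigenvalueP; exists (delta_mx 0 a).
  by rewrite -rowE row_diag_mx.
by apply/eqP=> /matrixP/(_ 0 a)/eqP; rewrite !mxE !eqxx oner_eq0.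
Qed.

Lemma Jblock_diag_mx r s (nn : 'I_s -> nat) (eps : C) (lam : 'I_s -> C) (j : 'I_s) :
  eps = 1 \/ eps = -1 -> ((r <= j)%N -> on_axis eps (lam j)) ->
  exists2 d : 'rV[C]_(bsize r nn j), Jblock r nn eps lam j = diag_mx d
    & forall a, exists b, d 0 b = mirror eps (d 0 a).
Proof.
move=> heps; rewrite leqNgt /Jblock /bsize; case: (j < r)%N => hon.
  exists (row_mx (const_mx (lam j)) (const_mx (mirror eps (lam j)))).
    by rewrite diag_mx_row !diag_const_mx.
  move=> a; rewrite -[a]splitK; case: (split a) => b /=.
    by exists (rshift _ b); rewrite row_mxEl row_mxEr !mxE.
  by exists (lshift _ b); rewrite row_mxEl row_mxEr !mxE mirrorK.
exists (const_mx (lam j)); first by rewrite diag_const_mx.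
by move=> a; exists a; rewrite !mxE; apply/esym/eqP; rewrite -on_axisE // hon.
Qed.

(** Entrywise the equation reads [(e_b - mirror d_a) W_ab = 0]. *)
Lemma sylvester_diag0 m p (eps : C) (d : 'rV[C]_m) (e : 'rV[C]_p)
    (W : 'M[C]_(m, p)) :
  eps = 1 \/ eps = -1 -> (forall a b, e 0 b != mirror eps (d 0 a)) ->
  W *m diag_mx e = - eps *: ((diag_mx d)^t* *m W) -> W = 0.
Proof.
move=> heps neq /matrixP h; apply/matrixP=> a b; rewrite mxE.
have := h a b; rewrite tr_diag_mx map_diag_mx mul_mx_diag mul_diag_mx !mxE.
rewrite mulrA -mirrorE // mulrC => /eqP.
by rewrite -subr_eq0 -mulrBl mulf_eq0 subr_eq0 (negbTE (neq a b)) => /eqP.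
Qed.

Lemma adjmx_mxblock p q (p_ : 'I_p -> nat) (q_ : 'I_q -> nat)
    (B : forall i j, 'M[C]_(p_ i, q_ j)) :
  (\mxblock_(i, j) B i j)^t* = \mxblock_(j, i) (B i j)^t*.
Proof. by rewrite tr_mxblock; apply/matrixP=> i j; rewrite !mxE. Qed.

Lemma adjmx_mxdiag p (p_ : 'I_p -> nat) (B : forall i, 'M[C]_(p_ i)) :
  (\mxdiag_i B i)^t* = \mxdiag_i (B i)^t*.
Proof.
rewrite adjmx_mxblock /mxdiag; apply: eq_mxblock => i j; rewrite eq_sym.
by case: eqVneq => [->|_]; rewrite ?conform_mx_id // trmx0 map_mx0.
Qed.

Lemma mul_mxdiag p (p_ : 'I_p -> nat) (A B : forall i, 'M[C]_(p_ i)) :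
  (\mxdiag_i A i) *m (\mxdiag_i B i) = \mxdiag_i (A i *m B i).
Proof.
rewrite {2}/mxdiag mul_mxdiag_mxblock; apply: eq_mxblock => i j.
by case: eqVneq => [->|_]; rewrite ?conform_mx_id // mulmx0.
Qed.

Lemma submxblock_mul_diag p (p_ : 'I_p -> nat) (M : 'M[C]_(\sum_i p_ i))
    (B : forall i, 'M[C]_(p_ i)) i j :
  submxblock (M *m \mxdiag_i B i) i j = submxblock M i j *m B j.
Proof. by rewrite -{1}[M]submxblockK mul_mxblock_mxdiag mxblockK. Qed.

Lemma submxblock_diag_mul p (p_ : 'I_p -> nat) (M : 'M[C]_(\sum_i p_ i))
    (B : forall i, 'M[C]_(p_ i)) i j :
  submxblock ((\mxdiag_i B i) *m M) i j = B i *m submxblock M i j.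
Proof. by rewrite -{1}[M]submxblockK mul_mxdiag_mxblock mxblockK. Qed.

Lemma Jdiag_congr r s (nn : 'I_s -> nat) (eps : C) (lam : 'I_s -> C) N
    (hdim : (\sum_(j < s) bsize r nn j)%N = N) (M J : 'M[C]_N) :
  eps = 1 \/ eps = -1 ->
  (forall i j : 'I_s, i != j -> forall z,
     ~ (eigenvalue (Jblock r nn eps lam i) z /\
        eigenvalue (Jblock r nn eps lam j) z)) ->
  (forall j : 'I_s, (j < r)%N -> ~~ on_axis eps (lam j)) ->
  (forall j : 'I_s, (r <= j)%N -> on_axis eps (lam j)) ->
  J = castmx (hdim, hdim) (\mxdiag_(j < s) Jblock r nn eps lam j) ->
  M^t* = - M -> M \in unitmx -> M *m J = - eps *: (J^t* *m M) ->
  exists (T : 'M[C]_N) (sg : forall j : 'I_s, 'I_(nn j) -> bool),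
    T *m J = J *m T /\
    T^t* *m M *m T *m castmx (hdim, hdim) (\mxdiag_(j < s) Gblock C r sg j) = 1%:M.
Proof.
move=> heps hdisj hoff hon.
(* Since [N] is a variable, [hdim] can be eliminated and the casts become identities. *)
case: N / hdim M J => M _ -> hM uM; rewrite !castmx_id => hcomm.
have hblk i j : submxblock M i j *m Jblock r nn eps lam j =
    - eps *: ((Jblock r nn eps lam i)^t* *m submxblock M i j).
  rewrite -submxblock_mul_diag hcomm adjmx_mxdiag /submxblock linearZ /=.
  by rewrite -/(submxblock _ i j) submxblock_diag_mul.
pose W j := submxblock M j j.
have defM : M = \mxdiag_j W j.
  rewrite -[LHS]submxblockK; apply: eq_mxblock => i j.
  case: eqVneq => [->|nij]; first by rewrite conform_mx_id.
  have [d hd dm] := Jblock_diag_mx nn heps (hon i).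
  have [e he _] := Jblock_diag_mx nn heps (hon j).
  have := hblk i j; rewrite hd he; apply: sylvester_diag0 => // a b.
  (* If [e_b] were the mirror of [d_a], it would be an eigenvalue of block [i] too, whose spectrum
     is closed under reflection. *)
  apply/eqP=> eab; apply: (hdisj i j nij (e 0 b)); rewrite hd he; split.
    by have [c hc] := dm a; rewrite eab -hc eigenvalue_diag_mx.
  exact: eigenvalue_diag_mx.
have hW j : (W j)^t* = - W j.
  move/eqP: hM; rewrite defM adjmx_mxdiag -mxdiagN => /eqP/eq_mxdiagP; exact.
have uW j : W j \in unitmx.
  have := mulmxV uM; rewrite {1}defM -mxdiagZ => /mxblockP/(_ j j).
  by rewrite submxblock_diag_mul submxblock_diag => /mulmx1_unit[].
have /fin_all_exists[sg] := fun j => Jblock_congr heps (hoff j) (hW j) (uW j) (hblk j j).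
case/fin_all_exists=> T hT.
exists (\mxdiag_j T j), sg; rewrite castmx_id defM adjmx_mxdiag !mul_mxdiag.
by split; [|rewrite -mxdiagZ]; apply: eq_mxdiag => j; have [h1 h2] := hT j; auto.
Qed.
End Blocks.

(** * Telescoping of double sums over a triangle *)

Lemma sum_triangle_shift (V : zmodType) k (h : nat -> nat -> V) :
  (forall p q, (k < p + q)%N -> h p q = 0) ->
  \sum_(p < k.+1) h p 0%N = 0 ->
  \sum_(p < k) \sum_(q < k) h p q.+1 = \sum_(p < k.+1) \sum_(q < k.+1) h p q.
Proof.
move=> h0 hp.
under [RHS]eq_bigr => p _ do rewrite big_ord_recl.
rewrite big_split /= hp add0r big_ord_recr /= [X in _ + X]big1 ?addr0 // => q _.
by rewrite h0 // addnS ltnS leq_addr.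
Qed.

(** Both sides equal the sum over the whole triangle [p + q <= k]: each shift drops one edge, whose
    sum is 0. The right side is the left one with [p] and [q] swapped. *)
Lemma sum_triangle_exchange (V : zmodType) k (h : nat -> nat -> V) :
  (forall p q, (k < p + q)%N -> h p q = 0) ->
  \sum_(p < k.+1) h p 0%N = 0 -> \sum_(q < k.+1) h 0%N q = 0 ->
  \sum_(p < k) \sum_(q < k) h p q.+1 = \sum_(p < k) \sum_(q < k) h p.+1 q.
Proof.
move=> h0 hp hq; rewrite sum_triangle_shift // exchange_big [RHS]exchange_big /=.
by rewrite (sum_triangle_shift (h := fun q p => h p q)) // => p q; rewrite addnC => /h0.
Qed.

(** * The coefficient matrix and its congruence by the stacked matrix *)

Section Pencil.
Local Open Scope sesquilinear_scope.
Variables (C : numClosedFieldType) (n k : nat) (A : 'I_k.+1 -> 'M[C]_n) (eps : C).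
Hypothesis heps : eps = 1 \/ eps = -1.
Hypothesis hA : structured A eps.

Lemma conj_sign : (- eps)^* = - eps.
Proof. by case: heps => ->; rewrite ?opprK ?rmorphN rmorph1. Qed.

Lemma sqr_sign : (- eps) ^+ 2 = 1.
Proof. by case: heps => ->; rewrite ?opprK ?sqrrN expr1n. Qed.

(** One sign for both parities: it is [(-1)^j] if [eps = 1] and always -1 if [eps = -1]. *)
Lemma structured_adj j : (j <= k)%N ->
  (A (inord j))^t* = - (- eps) ^+ j.+1 *: A (inord j).
Proof.
move=> hj; rewrite hA inordK //.
case: heps => ->; rewrite ?opprK ?expr1n ?scaleN1r ?if_same //.
by rewrite -signr_odd /=; case: (odd j); rewrite /= ?expr0 ?expr1 ?opprK ?scaleN1r.
Qed.

Lemma coefmx_adj : (coefmx A eps)^t* = - coefmx A eps.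
Proof.
rewrite /coefmx adjmx_mxblock -mxblockN; apply: eq_mxblock => p q.
rewrite [in LHS](addnC q); case: ifP => hpq; last by rewrite trmx0 map_mx0 oppr0.
rewrite linearZ /= map_mxZ structured_adj // scalerA mulrN scaleNr.
congr (- (_ *: _)); rewrite rmorphXn /= conj_sign -exprD.
(* The total exponent differs from [p] by an even number, and [(-eps)^2 = 1]. *)
have -> : (q + (p + q + 1).+1 = p + 2 * q.+1)%N by rewrite addn1; ring.
by rewrite exprD exprM sqr_sign expr1n mulr1.
Qed.

(** The matrix is block anti-triangular with the leading coefficient, up to sign, on the
    antidiagonal. For [v] in the left kernel, block column [k - 1 - p] involves only the blocks of
    [v] up to [p], so they vanish one after another. *)
Lemma coefmx_unit : A ord_max \in unitmx -> coefmx A eps \in unitmx.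
Proof.
move=> uA; rewrite -row_free_unit; apply: inj_row_free => v.
rewrite -[v]submxrowK /coefmx mul_mxrow_mxblock.
rewrite -(mxrow0 _ (q_ := fun=> n)) => /eq_mxrowP hv.
suff u0 m (p : 'I_k) : (p <= m)%N -> submxrow v p = 0.
  by apply: eq_mxrow => p; exact: (u0 p).
elim/ltn_ind: m p => m IH p pm; have := hv (rev_ord p).
have kp : (p + (k - p.+1) + 1 = k)%N by have := ltn_ord p; lia.
rewrite (bigD1 p) //= big1 ?addr0 => [|i nip].
  rewrite kp leqnn -scalemxAr => /eqP; rewrite scaler_eq0 expf_eq0.
  have -> : inord k = ord_max :> 'I_k.+1 by apply: val_inj; rewrite /= inordK.
  have -> : (- eps == 0) = false.
    by case: heps => ->; rewrite ?opprK ?oppr_eq0 oner_eq0.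
  by rewrite andbF => /eqP/(congr1 (mulmx^~ (invmx (A ord_max)))); rewrite mulmxK ?mul0mx.
have [ip|pi] := ltnP i p; first by rewrite (IH i) ?mul0mx // (leq_trans ip).
rewrite ifN ?mulmx0 // -ltnNge -[X in (X < _)%N]kp !ltn_add2r.
by rewrite ltn_neqAle eq_sym nip.
Qed.

Variables (X : 'M[C]_(n, blockdim k n)) (J : 'M[C]_(blockdim k n)).

(** This turns a change of standard pair into a congruence of the matrix [M]. *)
Lemma stackX_mul (T : 'M[C]_(blockdim k n)) : T *m J = J *m T ->
  stackX (X *m T) J = stackX X J *m T.
Proof.
move=> hT; rewrite /stackX mxcol_mul; apply: eq_mxcol => i.
rewrite -!mulmxA; congr (_ *m _).
by apply: (commrX i (x := T) hT).
Qed.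

Lemma stackX_congr_comm :
  \sum_(i < k.+1) A i *m X *m J ^+ i = 0 ->
  (stackX X J)^t* *m coefmx A eps *m stackX X J *m J =
  - eps *: (J^t* *m ((stackX X J)^t* *m coefmx A eps *m stackX X J)).
Proof.
move=> h0.
pose F i := X *m J ^+ i.
have FS i : F i.+1 = F i *m J by rewrite /F -mulmxA exprSr.
(* With [g] the summands of [M], right multiplication by [J] turns [g p q] into [h p q.+1], and left
   multiplication by [- eps *: J^t*] turns it into [h p.+1 q]. *)
pose h (p q : nat) : 'M[C]_(blockdim k n) := if (p + q <= k)%N
  then (- eps) ^+ p *: ((F p)^t* *m A (inord (p + q)) *m F q) else 0.
pose g (p q : nat) : 'M[C]_(blockdim k n) := if (p + q + 1 <= k)%N
  then (- eps) ^+ p *: ((F p)^t* *m A (inord (p + q + 1)) *m F q) else 0.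
have -> : (stackX X J)^t* *m coefmx A eps *m stackX X J =
  \sum_(p < k) \sum_(q < k) g p q.
  have -> : (stackX X J)^t* = \mxrow_(p < k) (F p)^t*.
    by rewrite /stackX tr_mxcol; apply/matrixP=> a b; rewrite !mxE.
  rewrite /coefmx /stackX mul_mxrow_mxblock mul_mxrow_mxcol exchange_big /=.
  apply: eq_bigr => q _; rewrite mulmx_suml; apply: eq_bigr => p _.
  by rewrite /g; case: ifP => _; rewrite ?mulmx0 ?mul0mx // -scalemxAr -scalemxAl.
rewrite mulmx_suml mulmx_sumr scaler_sumr.
transitivity (\sum_(p < k) \sum_(q < k) h p q.+1).
  apply: eq_bigr => p _; rewrite mulmx_suml; apply: eq_bigr => q _.
  by rewrite /h /g addn1 addnS; case: ifP => _; rewrite ?mul0mx // -scalemxAl FS mulmxA.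
transitivity (\sum_(p < k) \sum_(q < k) h p.+1 q); last first.
  apply: eq_bigr => p _; rewrite mulmx_sumr scaler_sumr; apply: eq_bigr => q _.
  rewrite /h /g addn1 addSn; case: ifP => _; rewrite ?mulmx0 ?scaler0 //.
  by rewrite -scalemxAr scalerA FS adjmxM !mulmxA exprS.
have h00 : \sum_(q < k.+1) A (inord q) *m F q = 0.
  rewrite -[RHS]h0; apply: eq_bigr => q _.
  by rewrite inord_val /F mulmxA.
apply: sum_triangle_exchange.
- by move=> p q; rewrite ltnNge /h => /negbTE ->.
(* The edge [q = 0] is the adjoint of the polynomial relation: the structure of [A] supplies the
   signs [(-eps)^p]. The edge [p = 0] below is the relation itself, multiplied by [X^t*]. *)
- transitivity (eps *: ((\sum_(q < k.+1) A (inord q) *m F q)^t* *m F 0%N)); last first.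
    by rewrite h00 trmx0 map_mx0 mul0mx scaler0.
  rewrite linear_sum /= raddf_sum /= mulmx_suml scaler_sumr; apply: eq_bigr => p _.
  rewrite adjmxM structured_adj -1?ltnS //.
  rewrite /h addn0 -ltnS ltn_ord -scalemxAr -scalemxAl scalerA mulrN -mulNr.
  by rewrite exprS mulrA -expr2 sqr_sign mul1r.
- transitivity ((F 0%N)^t* *m (\sum_(q < k.+1) A (inord q) *m F q)); last first.
    by rewrite h00 mulmx0.
  rewrite mulmx_sumr; apply: eq_bigr => q _.
  by rewrite /h add0n -ltnS ltn_ord expr0 scale1r mulmxA.
Qed.
End Pencil.

(** * Passage to the inverse, and the new standard pair *)

Lemma invmx_Sset (C : numClosedFieldType) N (eps : C) (J M : 'M[C]_N) :
  eps = 1 \/ eps = -1 ->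
  (M^t* = - M)%sesqui -> M \in unitmx ->
  M *m J = - eps *: ((J^t*)%sesqui *m M) -> Sset J eps (invmx M).
Proof.
move=> heps hM uM hcomm; split; apply: (can_inj (mulKmx uM)).
  rewrite mulmxN mulmxV //.
  by rewrite -[LHS]opprK -mulNmx -hM -adjmxM mulVmx // trmx1 map_mx1.
(* With [M] multiplied in on both sides, the claim becomes the commutation relation, as
   [(-eps)^2 = 1]. *)
apply: (can_inj (mulmxK uM)).
rewrite mulKVmx // -scalemxAr -scalemxAl mulmxA mulmxKV // hcomm scalerA.
by rewrite -expr2 sqr_sign // scale1r.
Qed.

Theorem theorem3p11 (R : realType) (n k : nat) (eps1 : R[i])
  (A : 'I_k.+1 -> 'M[R[i]]_n)
  (hn : (1 <= n)%N) (hk : (2 <= k)%N)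
  (heps1 : eps1 = 1 \/ eps1 = -1)
  (hstruct : structured A eps1)
  (hAk : A ord_max \in unitmx)
  (hss : all_semisimple A)
  (r s : nat) (hrs : (r <= s)%N)
  (nn : 'I_s -> nat) (lam : 'I_s -> R[i])
  (hdim : (\sum_(j < s) bsize r nn j)%N = blockdim k n)
  (Xs : forall j : 'I_s, 'M[R[i]]_(n, bsize r nn j))
  (X : 'M[R[i]]_(n, blockdim k n)) (J : 'M[R[i]]_(blockdim k n))
  (hX : X = castmx (erefl n, hdim) (\mxrow_(j < s) Xs j))
  (hJ : J = castmx (hdim, hdim) (\mxdiag_(j < s) Jblock r nn eps1 lam j))
  (hXJ : standard_pair A X J)
  (hdisj : forall i j : 'I_s, i != j -> forall z : R[i],
     ~ (eigenvalue (Jblock r nn eps1 lam i) z /\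
        eigenvalue (Jblock r nn eps1 lam j) z))
  (hoff : forall j : 'I_s, (j < r)%N -> ~~ on_axis eps1 (lam j))
  (hon : forall j : 'I_s, (r <= j)%N -> on_axis eps1 (lam j)) :
  exists (X' : 'M[R[i]]_(n, blockdim k n))
         (sg : forall j : 'I_s, 'I_(nn j) -> bool),
    [/\ standard_pair A X' J,
        Sset J eps1 (Gamma A eps1 X' J) &
        Gamma A eps1 X' J =
          castmx (hdim, hdim) (\mxdiag_(j < s) Gblock R[i] r sg j)].
Proof.
have [uS hS0] := hXJ.
set M := ((stackX X J)^t* *m coefmx A eps1 *m stackX X J)%sesqui.
have hM : (M^t* = - M)%sesqui.
  by rewrite /M !adjmxM trmxCK (coefmx_adj heps1 hstruct) mulNmx mulmxN mulmxA.
have uM : M \in unitmx.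
  by rewrite /M !unitmx_mul map_unitmx unitmx_tr uS coefmx_unit.
have hcomm := stackX_congr_comm heps1 hstruct hS0; rewrite -/M in hcomm.
have [T [sg [hT hG]]] := Jdiag_congr heps1 hdisj hoff hon hJ hM uM hcomm.
have defM' : ((stackX (X *m T) J)^t* *m coefmx A eps1 *m stackX (X *m T) J =
    T^t* *m M *m T)%sesqui.
  by rewrite stackX_mul // adjmxM /M !mulmxA.
(* The normal form is a right inverse of [T^t* *m M *m T], which makes [T] invertible and, in the
   last goal, identifies [Gamma]. *)
have [uM' _] := mulmx1_unit hG.
have uT : T \in unitmx by move: uM'; rewrite unitmx_mul => /andP[].
have hX'0 : \sum_(i < k.+1) A i *m (X *m T) *m J ^+ i = 0.
  rewrite -[RHS](mul0mx _ T) -[in RHS]hS0 mulmx_suml; apply: eq_bigr => i _.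
  by rewrite -!mulmxA; congr (_ *m (_ *m _)); exact: (commrX i (x := T) hT).
exists (X *m T), sg; split.
- by split; rewrite ?stackX_mul // unitmx_mul uS.
- rewrite /Gamma; apply: invmx_Sset; rewrite ?defM' //.
    by rewrite 2!adjmxM trmxCK hM mulNmx mulmxN mulmxA.
  by rewrite -defM' stackX_congr_comm.
- by rewrite /Gamma defM' -[invmx _]mulmx1 -hG mulKmx.
Qed.
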